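(* If $\mathcal{B}$ is a normal $\sqrt{\mathfrak{gl}_n}$-crystal, then $\mathsf{rect}(b)$ is a highest weight element for every $b\in\mathcal{B}$.
   Context: $[n]=\{1,\dots,n\}$, $\mathbf{e}_k$ standard basis of $\mathbb{Z}^n$. A $\sqrt{\mathfrak{gl}_n}$-crystal is a set $\mathcal{B}$ with $\mathrm{wt}:\mathcal{B}\to\mathbb{Z}^n$ and $e_i,f_i:\mathcal{B}\to\mathcal{B}\sqcup\{0\}$ ($i\in[n-1]$, $e_i(0)=f_i(0)=0$) such that, with $\varepsilon_i(b)=\sup\{k\ge0:e_i^k(b)\neq0\}$ and $\varphi_i(b)=\sup\{k\ge0:f_i^k(b)\ne0\}$: (a) both are finite and $\frac{\varphi_i(b)-\varepsilon_i(b)}{2}=\mathrm{wt}(b)_i-\mathrm{wt}(b)_{i+1}$; (b) $e_i(b)=c$ iff $f_i(c)=b$, and then $\mathrm{wt}(c)-\mathrm{wt}(b)=\mathbf{e}_i$ if $\varepsilon_i(b)$ even, $-\mathbf{e}_{i+1}$ if odd. Highest weight: $e_i(b)=0$ for all $i$. Full subcrystals are weakly connected components of the graph with edges $b\to f_i(b)$; isomorphisms preserve weights and operators. Tensor product: weights add; $e_i(b\otimes c)=b\otimes e_i(c)$ if $\varepsilon_i(b)\le\varphi_i(c)$ else $e_i(b)\otimes c$; $f_i(b\otimes c)=b\otimes f_i(c)$ if $\varepsilon_i(b)<\varphi_i(c)$ else $f_i(b)\otimes c$; $b\otimes0=0\otimes c=0$. $\mathbb{1}_n$: one element, weight $0$,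 zero operators. $\mathsf{SS}_n$: nonempty $S\subseteq[n]$, $\mathrm{wt}(S)=\sum_{j\in S}\mathbf{e}_j$, $e_i(S)=S\cup\{i\}$ if $S\cap\{i,i+1\}=\{i+1\}$, $S\setminus\{i+1\}$ if $S\cap\{i,i+1\}=\{i,i+1\}$, else $0$; $f_i(S)=S\cup\{i+1\}$ if $S\cap\{i,i+1\}=\{i\}$, $S\setminus\{i\}$ if $S\cap\{i,i+1\}=\{i,i+1\}$, else $0$. Normal: every full subcrystal is isomorphic to a full subcrystal of $\mathsf{SS}_n^{\otimes m}$ for some $m\ge0$ ($\mathsf{SS}_n^{\otimes0}=\mathbb{1}_n$). For $i\in[n-1]$ let $E_i(b)=e_i^{\varepsilon_i(b)}(b)$, and let $\mathsf{rect}=(E_1E_2\cdots E_{n-1})\cdots(E_1E_2E_3)(E_1E_2)(E_1)$, a composition of maps $\mathcal{B}\to\mathcal{B}$ (rightmost applied first). *)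

(* Defs.v *)
From Stdlib Require Import Relation_Operators.
From mathcomp Require Import all_boot all_order all_algebra.
From mathcomp Require Import boolp classical_sets functions.

Set Implicit Arguments.
Unset Strict Implicit.
Unset Printing Implicit Defensive.

Import GRing.Theory.
Local Open Scope ring_scope.

(* The indices are 0-based: [n] is 'I_n and [n-1] is 'I_n.-1; for i in [n-1],
   [idx i] and [idxS i] are i and i+1 seen as elements of [n]. *)
Definition idx n (i : 'I_n.-1) : 'I_n := widen_ord (leq_pred n) i.

Lemma idxS_subproof n (i : 'I_n.-1) : (i.+1 < n)%N.
Proof. by rewrite -ltn_predRL. Qed.

Definition idxS n (i : 'I_n.-1) : 'I_n := Ordinal (idxS_subproof i).

(* The data of a crystal, without its axioms; the element 0 is None. *)
Record precrystal (n : nat) : Type := Precrystal {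
  carrier :> Type;
  wt : carrier -> 'rV[int]_n;
  e_op : 'I_n.-1 -> carrier -> option carrier;
  f_op : 'I_n.-1 -> carrier -> option carrier }.

Definition opow (T : Type) (g : T -> option T) (k : nat) (b : T) : option T :=
  iter k (obind g) (Some b).

Definition string_set (T : Type) (g : T -> option T) (b : T) : set nat :=
  [set k | opow g k b <> None]%classic.

(* A string set contains 0. When it is unbounded, [supremum] returns the default
   value 0; this case is excluded by [is_crystal]. *)
Definition eps n (B : precrystal n) (i : 'I_n.-1) (b : B) : nat :=
  supremum 0%N (string_set (e_op i) b).

Definition phi n (B : precrystal n) (i : 'I_n.-1) (b : B) : nat :=
  supremum 0%N (string_set (f_op i) b).

Record is_crystal n (B : precrystal n) : Prop := IsCrystal {
  eps_finite : forall (i : 'I_n.-1) (b : B),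
    has_ubound (string_set (e_op i) b);
  phi_finite : forall (i : 'I_n.-1) (b : B),
    has_ubound (string_set (f_op i) b);
  phi_sub_eps : forall (i : 'I_n.-1) (b : B),
    ((phi i b)%:R - (eps i b)%:R) / 2%:R
      = (wt b 0 (idx i) - wt b 0 (idxS i))%:~R :> rat;
  e_op_f_op : forall (i : 'I_n.-1) (b c : B),
    e_op i b = Some c <-> f_op i c = Some b;
  wt_e_op : forall (i : 'I_n.-1) (b c : B),
    e_op i b = Some c ->
    wt c - wt b = if odd (eps i b) then - delta_mx 0 (idxS i)
                  else delta_mx 0 (idx i) }.

Definition highest_weight n (B : precrystal n) (b : B) : Prop :=
  forall i : 'I_n.-1, e_op i b = None.

Definition crystal_edge n (B : precrystal n) (b c : B) : Prop :=
  exists i : 'I_n.-1, f_op i b = Some c.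

Definition weakly_connected n (B : precrystal n) (b c : B) : Prop :=
  clos_refl_sym_trans B (@crystal_edge n B) b c.

(* A full subcrystal is given by its underlying set; the operators of B
   restrict to it. *)
Definition full_subcrystal n (B : precrystal n) (X : set B) : Prop :=
  exists b : B, X = [set c | weakly_connected b c]%classic.

Definition subcrystal_iso n (B C : precrystal n) (X : set B) (Y : set C) :
    Prop :=
  exists g : B -> C,
    set_bij X Y g /\
    forall b : B, X b ->
      wt (g b) = wt b /\
      forall i : 'I_n.-1,
        e_op i (g b) = omap g (e_op i b) /\ f_op i (g b) = omap g (f_op i b).

Definition tensor n (B C : precrystal n) : precrystal n :=
  @Precrystal n (B * C)%type
    (fun x => wt x.1 + wt x.2)
    (fun i x => if (eps i x.1 <= phi i x.2)%N
                then omap (fun c => (x.1, c)) (e_op i x.2)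
                else omap (fun b => (b, x.2)) (e_op i x.1))
    (fun i x => if (eps i x.1 < phi i x.2)%N
                then omap (fun c => (x.1, c)) (f_op i x.2)
                else omap (fun b => (b, x.2)) (f_op i x.1)).

Definition unit_crystal n : precrystal n :=
  @Precrystal n unit (fun _ => 0) (fun _ _ => None) (fun _ _ => None).

Definition set_e n (i : 'I_n.-1) (S : {set 'I_n}) : option {set 'I_n} :=
  let P := [set idx i; idxS i]%SET in
  if S :&: P == [set idxS i]%SET then Some (idx i |: S)
  else if S :&: P == P then Some (S :\ idxS i)
  else None.

Definition set_f n (i : 'I_n.-1) (S : {set 'I_n}) : option {set 'I_n} :=
  let P := [set idx i; idxS i]%SET in
  if S :&: P == [set idx i]%SET then Some (idxS i |: S)
  else if S :&: P == P then Some (S :\ idx i)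
  else None.

Lemma idx_neq_idxS n (i : 'I_n.-1) : idx i != idxS i.
Proof. by rewrite -val_eqE /= neq_ltn ltnSn. Qed.

Lemma set_e_neq0 n (i : 'I_n.-1) (S S' : {set 'I_n}) :
  set_e i S = Some S' -> S' != finset.set0.
Proof.
rewrite /set_e; case: ifP => [_ [<-]|_].
  by apply/finset.set0Pn; exists (idx i); rewrite !inE eqxx.
case: ifP => // /eqP/finset.setIidPr /fintype.subsetP sS [<-].
apply/finset.set0Pn; exists (idx i).
by rewrite !inE idx_neq_idxS sS // !inE eqxx.
Qed.

Lemma set_f_neq0 n (i : 'I_n.-1) (S S' : {set 'I_n}) :
  set_f i S = Some S' -> S' != finset.set0.
Proof.
rewrite /set_f; case: ifP => [_ [<-]|_].
  by apply/finset.set0Pn; exists (idxS i); rewrite !inE eqxx.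
case: ifP => // /eqP/finset.setIidPr /fintype.subsetP sS [<-].
apply/finset.set0Pn; exists (idxS i).
by rewrite !inE eq_sym idx_neq_idxS sS // !inE eqxx orbT.
Qed.

Definition nonempty_set n := {S : {set 'I_n} | S != finset.set0}.

(* By [set_e_neq0] and [set_f_neq0], [insub] does not fail here. *)
Definition SS n : precrystal n :=
  @Precrystal n (nonempty_set n)
    (fun S => \sum_(j in val S) delta_mx 0 j)
    (fun i S => obind insub (set_e i (val S)))
    (fun i S => obind insub (set_f i (val S))).

Definition SS_pow n (m : nat) : precrystal n :=
  iterop m (@tensor n) (SS n) (unit_crystal n).

Definition normal n (B : precrystal n) : Prop :=
  forall X : set B, full_subcrystal X ->
    exists (m : nat) (Y : set (SS_pow n m)),
      full_subcrystal Y /\ subcrystal_iso X Y.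

(* The default value is not used when the string is finite: the power of e_i is
   then nonzero, by definition of [eps]. *)
Definition E_op n (B : precrystal n) (i : 'I_n.-1) (b : B) : B :=
  odflt b (opow (e_op i) (eps i b) b).

(* E_block k = E_0 E_1 ... E_k, with E_k applied first. *)
Definition E_block n (B : precrystal n) (k : 'I_n.-1) (b : B) : B :=
  foldr (@E_op n B) b [seq i : 'I_n.-1 <- enum 'I_n.-1 | (i <= k)%N].

Definition rect n (B : precrystal n) (b : B) : B :=
  foldl (fun x k => E_block k x) b (enum 'I_n.-1).

(* Main.v *)
(* A normal crystal is locally a crystal of words S_1 (x) ... (x) S_m of
   nonempty sets, so it suffices to raise words.  Operators with distant indices
   act on disjoint letters, hence do not interact, and an induction along each
   block E_0 E_1 ... E_k reduces the theorem to rank two: if eps_i(x) = 0 and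
   j = i + 1, then eps_j(E_i E_j x) = 0.
   For that, words are read from right to left.  By the tensor product rule,
   adding a letter on the left of c changes eps, phi and the letter output by E_i
   in a way that depends on c only through phi_i(c).  So E_i E_j is a finite
   composition of counter automata, and the string lengths of x, E_j x and
   E_i E_j x satisfy a system of linear relations (string_inv) that each new
   letter preserves and that forces every j + 1 in E_i E_j x to be matched. *)

From mathcomp Require Import all_boot all_order zify.
From mathcomp Require Import classical_sets.
Require Import Defs.

Set Implicit Arguments.
Unset Strict Implicit.
Unset Printing Implicit Defensive.

Local Open Scope nat_scope.

(** * String lengths of a partial operator *)

Section Strings.
Variables (T : Type) (g : T -> option T).

Lemma opowS k b : opow g k.+1 b = obind (opow g k) (g b).
Proof.
rewrite /opow iterSr /=; case: (g b) => //=.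
by elim: k => //= k ->.
Qed.

(** By induction on k, the k-th power of g is defined at c exactly when k <= N c, so the string set
    of b is {0, ..., N b}. This replaces suprema by a local check along edges. *)
Lemma supremum_string (N : T -> nat) :
    (forall b, g b = None -> N b = 0) ->
    (forall b c, g b = Some c -> N b = (N c).+1) ->
  forall b, supremum 0 (string_set g b) = N b.
Proof.
move=> N0 NS b.
have strE k c : opow g k c <> None <-> k <= N c.
  elim: k c => [|k IHk] c; first by split.
  rewrite opowS; case gc: (g c) => [d|] /=.
    by rewrite (NS _ _ gc) ltnS; apply: IHk.
  by rewrite (N0 _ gc); split.
have NbP : supremums (string_set g b) (N b).
  by split=> [k /strE//|k]; apply; apply/strE.
(* The default branch of [supremum] is taken only for the empty set, and a string set contains 0. *)
rewrite /supremum ifF; last first.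
  by apply/negP => /eqP E; have : string_set g b 0 by []; rewrite E.
by apply: (is_subset1_supremums (xgetPex _ _) NbP); exists (N b).
Qed.

End Strings.

(** * Seminormal crystals and maximal raising *)

Record seminormal n (B : precrystal n) : Prop := Seminormal {
  e_None : forall i (b : B), e_op i b = None -> eps i b = 0;
  f_None : forall i (b : B), f_op i b = None -> phi i b = 0;
  e_Some : forall i (b c : B), e_op i b = Some c ->
    eps i b = (eps i c).+1 /\ phi i c = (phi i b).+1;
  f_Some : forall i (b c : B), f_op i b = Some c ->
    phi i b = (phi i c).+1 /\ eps i c = (eps i b).+1 }.

(** Candidate string lengths that change correctly along edges are the true ones; this computes
    [eps] and [phi] in each concrete crystal together with seminormality. *)
Lemma seminormal_of n (B : precrystal n) (N M : 'I_n.-1 -> B -> nat) :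
    (forall i b, e_op i b = None -> N i b = 0) ->
    (forall i b, f_op i b = None -> M i b = 0) ->
    (forall i b c, e_op i b = Some c ->
       N i b = (N i c).+1 /\ M i c = (M i b).+1) ->
    (forall i b c, f_op i b = Some c ->
       M i b = (M i c).+1 /\ N i c = (N i b).+1) ->
  [/\ seminormal B, forall i b, eps i b = N i b & forall i b, phi i b = M i b].
Proof.
move=> e0 f0 eS fS.
have epsE i b : eps i b = N i b.
  by apply: supremum_string => [|c d /eS[]]//; apply: e0.
have phiE i b : phi i b = M i b.
  by apply: supremum_string => [|c d /fS[]]//; apply: f0.
by split=> //; split=> *; rewrite ?epsE ?phiE; auto.
Qed.

(* e_i^(eps b - h) b: what the maximal raising of b (x) c does to the left
   factor, when h = phi_i(c). *)
Definition E_cut n (B : precrystal n) (i : 'I_n.-1) (h : nat) (b : B) : B :=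
  odflt b (opow (e_op i) (eps i b - h) b).

Section Seminormal.
Variables (n : nat) (B : precrystal n) (sB : seminormal B).

Lemma eps_eq0 i (b : B) : eps i b = 0 -> e_op i b = None.
Proof. by case eb: (e_op i b) => [c|] //; case: (e_Some sB eb) => ->. Qed.

Lemma E_cut_Some i h (b c : B) :
  e_op i b = Some c -> h < eps i b -> E_cut i h b = E_cut i h c.
Proof.
move=> eb; case: (e_Some sB eb) => epsb _; rewrite /E_cut epsb ltnS => hc.
rewrite subSn // opowS eb /=.
(* The two sides have different defaults, b and c, so the power has to be defined. *)
suff : opow (e_op i) (eps i c - h) c <> None.
  by case: (opow _ _ _).
move: (eps i c - h) (leq_subr h (eps i c)) => k {eb epsb hc b}.
elim: k c => [|k IHk] c // kc; rewrite opowS.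
case ec: (e_op i c) => [d|] /=; last by rewrite (e_None sB ec) in kc.
by apply: IHk; case: (e_Some sB ec) kc => ->.
Qed.

Lemma E_cut_id i h (b : B) : eps i b <= h -> E_cut i h b = b.
Proof. by rewrite -subn_eq0 /E_cut => /eqP ->. Qed.

Lemma E_op_cut i (b : B) : E_op i b = E_cut i 0 b.
Proof. by rewrite /E_cut subn0. Qed.

Lemma E_op_Some i (b c : B) : e_op i b = Some c -> E_op i b = E_op i c.
Proof.
by move=> eb; rewrite !E_op_cut (E_cut_Some eb) //; case: (e_Some sB eb) => ->.
Qed.

Lemma E_op_None i (b : B) : e_op i b = None -> E_op i b = b.
Proof. by move=> eb; rewrite E_op_cut E_cut_id // (e_None sB eb). Qed.

Lemma eps_E_op i (b : B) : eps i (E_op i b) = 0.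
Proof.
have [k] := ubnP (eps i b); elim: k b => // k IHk b.
case eb: (e_op i b) => [c|] bk; last by rewrite E_op_None // (e_None sB eb).
by rewrite (E_op_Some eb); apply: IHk; case: (e_Some sB eb) bk => ->.
Qed.

End Seminormal.

(** * Tensor products *)

Section Tensor.
Variables (n : nat) (B C : precrystal n).
Hypotheses (sB : seminormal B) (sC : seminormal C).

(** Bracketing rule: raising steps of the left factor are cancelled against lowering steps of the
    right one, and truncated subtraction counts what is left over. *)
Lemma tensor_spec :
  [/\ seminormal (tensor B C),
      forall i (x : tensor B C),
        eps i x = eps i x.2 + (eps i x.1 - phi i x.2) &
      forall i (x : tensor B C),
        phi i x = phi i x.1 + (phi i x.2 - eps i x.1)].
Proof.
apply: seminormal_of => i [b c] /=.
- case: ifP => h.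
    by case ec: (e_op i c) => //= _; move: (e_None sC ec); lia.
  by case eb: (e_op i b) => //= _; move: (e_None sB eb); lia.
- case: ifP => h.
    by case ec: (f_op i c) => //= _; move: (f_None sC ec); lia.
  by case eb: (f_op i b) => //= _; move: (f_None sB eb); lia.
- move=> [b' c']; case: ifP => h.
    by case ec: (e_op i c) => [d|] //= [<- <-]; move: (e_Some sC ec); lia.
  by case eb: (e_op i b) => [d|] //= [<- <-]; move: (e_Some sB eb); lia.
- move=> [b' c']; case: ifP => h.
    by case ec: (f_op i c) => [d|] //= [<- <-]; move: (f_Some sC ec); lia.
  by case eb: (f_op i b) => [d|] //= [<- <-]; move: (f_Some sB eb); lia.
Qed.

Lemma seminormal_tensor : seminormal (tensor B C).
Proof. by case: tensor_spec. Qed.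

Lemma eps_tensor i (x : tensor B C) :
  eps i x = eps i x.2 + (eps i x.1 - phi i x.2).
Proof. by case: tensor_spec. Qed.

Lemma phi_tensor i (x : tensor B C) :
  phi i x = phi i x.1 + (phi i x.2 - eps i x.1).
Proof. by case: tensor_spec. Qed.

(** The operator first acts on the left factor until its eps_i drops to phi_i of the right factor,
    and from then on only on the right one. *)
Lemma E_op_tensor i (x : tensor B C) :
  E_op i x = (E_cut i (phi i x.2) x.1, E_op i x.2) :> tensor B C.
Proof.
have sBC := seminormal_tensor.
have [k] := ubnP (eps i x); elim: k x => // k IHk x.
case ex: (e_op i x) => [y|] xk; last first.
  rewrite (E_op_None sBC) //; have := e_None sBC ex; rewrite eps_tensor => /eqP.
  rewrite addn_eq0 => /andP[/eqP x2 /eqP x1].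
  rewrite (E_op_None sC) ?(eps_eq0 sC) // E_cut_id; last by lia.
  by case: (x).
rewrite (E_op_Some sBC ex) IHk; last by case: (e_Some sBC ex) xk => ->.
case: x y ex {xk} => b c [b' c'] /=; case: ifP => h.
  case ec: (e_op i c) => [d|] //= [<- <-]; rewrite (E_op_Some sC ec).
  (* Raising c increases phi_i(c), so the left factor stays below the cut. *)
  by case: (e_Some sC ec) => _ phic; rewrite !E_cut_id //; lia.
case eb: (e_op i b) => [d|] //= [<- <-].
by rewrite (E_cut_Some sB eb) //; lia.
Qed.

End Tensor.

(** * Letters: the crystal of nonempty sets *)

(** The bits p and q record whether i and i + 1 lie in a letter. The f_i-string is {i}, {i, i+1},
    {i+1} on these two entries, hence lengths up to 2. *)
Definition eps_bits (p q : bool) := if q then (if p then 1 else 2) else 0.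
Definition phi_bits (p q : bool) := if p then (if q then 1 else 2) else 0.

(** Effect of [E_cut] on the two bits; two raising steps are possible only from {i+1}, and they end
    at {i}. *)
Definition cut_bits (h : nat) (p q : bool) : bool * bool :=
  match eps_bits p q - h with
  | 0 => (p, q)
  | 1 => if p then (true, false) else (true, true)
  | _ => (true, false)
  end.

Lemma idxS_neq_idx n (i : 'I_n.-1) : idxS i == idx i = false.
Proof. by rewrite eq_sym; apply/negbTE/idx_neq_idxS. Qed.

Lemma setI_pair (T : finType) (x y : T) (S : {set T}) :
  (S :&: [set x; y] == [set x; y])%SET = (x \in S) && (y \in S).
Proof.
by rewrite (sameP eqP finset.setIidPr) finset.subUset !finset.sub1set.
Qed.

Lemma set_eE n (i : 'I_n.-1) (S : {set 'I_n}) :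
  set_e i S = if idxS i \in S
              then Some (if idx i \in S then S :\ idxS i else idx i |: S)
              else None.
Proof.
rewrite /set_e.
have -> : (S :&: [set idx i; idxS i] == [set idxS i])%SET =
          (idx i \notin S) && (idxS i \in S).
  apply/eqP/andP => [/setP E|[pS qS]].
    move: (E (idx i)) (E (idxS i)); rewrite !inE !eqxx orbT andbT.
    by rewrite (negbTE (idx_neq_idxS i)) /= andbT => -> ->.
  apply/setP => k; rewrite !inE; case: (k =P idxS i) => [->|_].
    by rewrite qS orbT.
  by case: (k =P idx i) => [->|_]; rewrite ?(negbTE pS) ?andbF.
by rewrite setI_pair; do 2![case: (_ \in S)].
Qed.

Lemma set_fE n (i : 'I_n.-1) (S : {set 'I_n}) :
  set_f i S = if idx i \in S
              then Some (if idxS i \in S then S :\ idx i else idxS i |: S)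
              else None.
Proof.
rewrite /set_f.
have -> : (S :&: [set idx i; idxS i] == [set idx i])%SET =
          (idxS i \notin S) && (idx i \in S).
  apply/eqP/andP => [/setP E|[pS qS]].
    move: (E (idx i)) (E (idxS i)); rewrite !inE !eqxx orbT !andbT.
    by rewrite idxS_neq_idx => -> ->.
  apply/setP => k; rewrite !inE; case: (k =P idx i) => [->|_].
    by rewrite qS.
  by case: (k =P idxS i) => [->|_]; rewrite ?(negbTE pS) ?andbF.
by rewrite setI_pair; do 2![case: (_ \in S)].
Qed.

Section SetCrystal.
Variable n : nat.
Implicit Types (i : 'I_n.-1) (S : SS n).

Lemma SS_e i S : omap val (e_op i S) = set_e i (val S).
Proof.
rewrite /=; case E: (set_e i (val S)) => [T|] //=.
by rewrite (insubT (fun X : {set 'I_n} => X != finset.set0) (set_e_neq0 E)).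
Qed.

Lemma SS_f i S : omap val (f_op i S) = set_f i (val S).
Proof.
rewrite /=; case E: (set_f i (val S)) => [T|] //=.
by rewrite (insubT (fun X : {set 'I_n} => X != finset.set0) (set_f_neq0 E)).
Qed.

Lemma SS_e_Some i S T : e_op i S = Some T -> set_e i (val S) = Some (val T).
Proof. by move=> E; rewrite -SS_e E. Qed.

Lemma SS_f_Some i S T : f_op i S = Some T -> set_f i (val S) = Some (val T).
Proof. by move=> E; rewrite -SS_f E. Qed.

Lemma SS_spec :
  [/\ seminormal (SS n),
      forall i S, eps i S = eps_bits (idx i \in val S) (idxS i \in val S) &
      forall i S, phi i S = phi_bits (idx i \in val S) (idxS i \in val S)].
Proof.
apply: seminormal_of => i S.
- by move=> E; move: (SS_e i S); rewrite E set_eE; case: (_ \in _).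
- by move=> E; move: (SS_f i S); rewrite E set_fE; case: (_ \in _).
- move=> T /SS_e_Some; rewrite set_eE.
  case: ifP => // q; case: ifP => p /Some_inj <-; rewrite !inE ?eqxx ?p ?q.
    by rewrite (negbTE (idx_neq_idxS i)).
  by rewrite idxS_neq_idx.
- move=> T /SS_f_Some; rewrite set_fE.
  case: ifP => // p; case: ifP => q /Some_inj <-; rewrite !inE ?eqxx ?p ?q.
    by rewrite idxS_neq_idx.
  by rewrite (negbTE (idx_neq_idxS i)).
Qed.

Lemma seminormal_SS : seminormal (SS n).
Proof. by case: SS_spec. Qed.

Lemma eps_SS i S : eps i S = eps_bits (idx i \in val S) (idxS i \in val S).
Proof. by case: SS_spec. Qed.

Lemma phi_SS i S : phi i S = phi_bits (idx i \in val S) (idxS i \in val S).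
Proof. by case: SS_spec. Qed.

Lemma E_cut_SS i h S k :
  let pq := cut_bits h (idx i \in val S) (idxS i \in val S) in
  (k \in val (E_cut i h S)) =
    if k == idx i then pq.1 else if k == idxS i then pq.2 else k \in val S.
Proof.
move=> pq; rewrite {}/pq /cut_bits -eps_SS.
have [d] := ubnP (eps i S); elim: d S => // d IHd S epsd.
have [le|lt] := leqP (eps i S) h.
  rewrite E_cut_id //; move: le; rewrite -subn_eq0 => /eqP -> /=.
  by do 2![case: eqP => [->|_] //].
case E: (e_op i S) => [T|]; last by move: (e_None seminormal_SS E) lt => ->.
rewrite (E_cut_Some seminormal_SS E lt).
have [epsT _] := e_Some seminormal_SS E.
rewrite IHd; last by lia.
move/SS_e_Some: E; rewrite set_eE.
move: epsT lt epsd; rewrite !eps_SS.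
case: ifP => // q; case: ifP => p + + + /Some_inj <-; rewrite !inE ?eqxx ?p ?q /=.
  rewrite (negbTE (idx_neq_idxS i)) /= {IHd} => _ + _; case: h => //= _.
  by do 2![case: eqP => //=].
rewrite idxS_neq_idx /= {IHd} => _ + _; case: h => [|[|h]] //= _.
  by do 2![case: eqP => //=].
by do 2![case: eqP => //=].
Qed.

End SetCrystal.

(** * Words: tensor powers of the letter crystal *)

(** [iterop] does not put the unit crystal inside positive powers, so the exponents 0 and 1 are
    separate base cases; each further letter is added on the left. *)
Lemma SS_pow_ind n (P : precrystal n -> Prop) :
    P (unit_crystal n) -> P (SS n) ->
    (forall C, seminormal C -> P C -> P (tensor (SS n) C)) ->
  forall m, P (SS_pow n m).
Proof.
move=> P0 P1 PS.
suff H m : seminormal (SS_pow n m.+1) /\ P (SS_pow n m.+1).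
  by case=> [|m] //; case: (H m).
elim: m => [|m [sm Pm]]; first by split; first exact: seminormal_SS.
by split; [apply: (seminormal_tensor (@seminormal_SS n) sm)|apply: PS].
Qed.

Lemma unit_spec n :
  [/\ seminormal (unit_crystal n),
      forall i (b : unit_crystal n), eps i b = 0 &
      forall i (b : unit_crystal n), phi i b = 0].
Proof. exact: seminormal_of. Qed.

Lemma seminormal_SS_pow n m : seminormal (SS_pow n m).
Proof.
apply: SS_pow_ind m => [||C sC _]; first by case: (unit_spec n).
  exact: seminormal_SS.
exact: seminormal_tensor (@seminormal_SS n) sC.
Qed.

(** * Distant indices *)

Definition far n (i j : 'I_n.-1) := (i.+1 < j) || (j.+1 < i).

Lemma E_cut_far n (i j : 'I_n.-1) h (S : SS n) : far i j ->
  eps i (E_cut j h S) = eps i S /\ phi i (E_cut j h S) = phi i S.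
Proof.
move=> fij; rewrite !eps_SS !phi_SS !E_cut_SS -!val_eqE /=.
by rewrite !ifF //; move: fij; rewrite /far; lia.
Qed.

(** In each letter the cut at j modifies only j and j + 1, whatever the height of the cut, and index
    i reads only i and i + 1. *)
Lemma E_op_far n m (i j : 'I_n.-1) (b : SS_pow n m) : far i j ->
  eps i (E_op j b) = eps i b /\ phi i (E_op j b) = phi i b.
Proof.
move=> fij; move: b; apply: (@SS_pow_ind n (fun B => forall b : B,
  eps i (E_op j b) = eps i b /\ phi i (E_op j b) = phi i b)).
- by case: (unit_spec n) => _ eps0 phi0 b; rewrite !eps0 !phi0.
- by move=> S; rewrite E_op_cut; apply: E_cut_far.
- move=> C sC IH [S c]; rewrite (E_op_tensor (@seminormal_SS n) sC).
  rewrite !(eps_tensor (@seminormal_SS n) sC).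
  rewrite !(phi_tensor (@seminormal_SS n) sC).
  by case: (E_cut_far (phi j c) S fij) (IH c) => /= -> -> [-> ->].
Qed.

(** * Rank two: adjacent indices *)

(* Here a = phi_i(x), e2 = eps_j(x), p2 = phi_j(x), e1 = eps_i(E_j x),
   p1 = phi_i(E_j x) and c = phi_j(E_i E_j x), for j = i + 1 and eps_i(x) = 0.
   The two equations compare weights; the inequality is the interlacing
   condition of string parametrizations. *)
Definition string_inv (a e2 p2 e1 p1 c : nat) : Prop :=
  [/\ a %% 2 = 0, e2 %% 2 = p2 %% 2, e1 <= 2 * (e2 %/ 2),
      p1 + 2 * (e2 %/ 2) = a + e1 & c + 2 * (e1.+1 %/ 2) = p2 + e2].

(** The bits p, q, r tell whether i, i + 1, i + 2 lie in the new letter; r1 and q2 are the final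
    values of the last two. The bound on [eps_bits p q] keeps eps_i of the longer word at 0, and the
    bound on [eps_bits q2 r1] does the same for eps_j after both raisings. *)
Lemma string_inv_step (p q r : bool) (a e2 p2 e1 p1 c : nat) :
    string_inv a e2 p2 e1 p1 c -> eps_bits p q <= a ->
  let: (q1, r1) := cut_bits p2 q r in
  let: (_, q2) := cut_bits p1 p q1 in
  eps_bits q2 r1 <= c /\
  string_inv (phi_bits p q + (a - eps_bits p q))
    (e2 + (eps_bits q r - p2)) (phi_bits q r + (p2 - eps_bits q r))
    (e1 + (eps_bits p q1 - p1)) (phi_bits p q1 + (p1 - eps_bits p q1))
    (phi_bits q2 r1 + (c - eps_bits q2 r1)).
Proof.
case=> i1 i2 i3 i4 i5; rewrite /string_inv.
case: p q r => [] [] [] /= le;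
 (* A letter has eps at most 2, so a cut height matters only as 0, 1 or at least 2. *)
 case: p2 i2 i5 => [|[|p2]] i2 i5 /=;
 case: p1 i4 => [|[|p1]] i4 /=; do ?split; lia.
Qed.

Section RankTwo.
Variables (n : nat) (i j : 'I_n.-1).
Hypothesis ij : j = i.+1 :> nat.

Lemma letter_step (S : SS n) (a e2 p2 e1 p1 c : nat) :
    string_inv a e2 p2 e1 p1 c -> eps i S <= a ->
  let S1 := E_cut j p2 S in
  let S2 := E_cut i p1 S1 in
  eps j S2 <= c /\
  string_inv (phi i S + (a - eps i S))
    (e2 + (eps j S - p2)) (phi j S + (p2 - eps j S))
    (e1 + (eps i S1 - p1)) (phi i S1 + (p1 - eps i S1))
    (phi j S2 + (c - eps j S2)).
Proof.
move=> inv le S1 S2.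
(* The second bit for i is the first bit for j, so three bits suffice. *)
have idxj : idx j = idxS i by apply: val_inj.
have n1 : (idx i == idxS i) = false by apply/negbTE/idx_neq_idxS.
have n2 : (idx i == idxS j) = false by rewrite -val_eqE /= ij; lia.
have n3 : (idxS j == idxS i) = false by rewrite -val_eqE /= ij; lia.
have n4 : (idxS j == idx i) = false by rewrite eq_sym.
have := le; rewrite eps_SS => /(string_inv_step (idxS j \in val S) inv).
rewrite !(eps_SS, phi_SS) !E_cut_SS !idxj !eqxx idxS_neq_idx n1 n2 n3 n4.
by case: (cut_bits p2 _ _) => q1 r1 /=; case: (cut_bits p1 _ _).
Qed.

Lemma rank_two m (x : SS_pow n m) : eps i x = 0 ->
  eps j (E_op i (E_op j x)) = 0 /\
  string_inv (phi i x) (eps j x) (phi j x)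
    (eps i (E_op j x)) (phi i (E_op j x)) (phi j (E_op i (E_op j x))).
Proof.
move: x; apply: (@SS_pow_ind n (fun B => forall x : B, eps i x = 0 ->
  eps j (E_op i (E_op j x)) = 0 /\
  string_inv (phi i x) (eps j x) (phi j x)
    (eps i (E_op j x)) (phi i (E_op j x)) (phi j (E_op i (E_op j x))))).
- by case: (unit_spec n) => _ eps0 phi0 x _; rewrite !eps0 !phi0.
(* A single letter is treated as added to an empty word, whose counters all vanish. *)
- have inv0 : string_inv 0 0 0 0 0 0 by [].
  move=> S epsS; rewrite !E_op_cut; have := letter_step (S := S) inv0.
  rewrite epsS => /(_ erefl) /=; rewrite leqn0 => -[/eqP -> ].
  by rewrite !sub0n !subn0 !addn0 !add0n.
- move=> C sC IH [S c]; have sS := @seminormal_SS n.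
  rewrite !(E_op_tensor sS sC) !(eps_tensor sS sC) !(phi_tensor sS sC) /=.
  move/eqP; rewrite addn_eq0 subn_eq0 => /andP[/eqP epsc epsS].
  have [-> inv] := IH c epsc.
  have [le inv'] := letter_step inv epsS.
  by split=> //; apply/eqP; rewrite add0n subn_eq0.
Qed.

End RankTwo.

(** * Induction along the blocks of [rect] *)

(** Here s is j, ..., k, so the fold is E_j ... E_k x. Applying E_j may spoil only the index j - 1,
    which is the exception in the conclusion and is repaired by the next operator. *)
Lemma E_chain_highest n m (x : SS_pow n m) (k : nat) :
    (forall i : 'I_n.-1, i < k -> eps i x = 0) ->
  forall (s : seq 'I_n.-1) (j : nat),
    map val s = iota j (k.+1 - j) -> j <= k.+1 ->
  forall i : 'I_n.-1, i <= k -> i.+1 != j ->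
    eps i (foldr (@E_op n (SS_pow n m)) x s) = 0.
Proof.
move=> hx s; have sW := seminormal_SS_pow n m.
(* Strong induction on the size, because the rank-two step removes two operators at once. *)
have [N] := ubnP (size s); elim: N s => // N IH [|a s] sN j /=.
  move=> /(congr1 size); rewrite size_iota /= => kj jk i ik ij.
  by apply: hx; lia.
move=> E jk i ik ij.
have jk' : k.+1 - j = (k - j).+1.
  by move: (congr1 size E); rewrite /= size_iota; lia.
move: E; rewrite jk' => -[/= aj Es].
have [ia|ia] := eqVneq i a; first by rewrite ia (eps_E_op sW).
rewrite -val_eqE /= in ia; rewrite /= in sN.
have [fia|nfia] := boolP (far i a).
  have [-> _] := E_op_far (foldr (@E_op n (SS_pow n m)) x s) fia.
  by apply: (IH s _ j.+1); rewrite ?Es ?subSS //; lia.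
(* The other neighbour, a - 1 = j - 1, is the excluded index. *)
have ia' : i = a.+1 :> nat.
  by move: nfia ia; rewrite /far; lia.
case: s sN Es => [|b s] sN /=.
  by move=> /(congr1 size); rewrite size_iota /=; lia.
have -> : k - j = (k - j.+1).+1 by lia.
move=> -[bj Es]; have -> : i = b by apply: val_inj; rewrite /= bj ia' aj.
(* The remaining chain starts at j + 2 and excludes only j + 1, so its claim covers a = j. *)
suff epsa : eps a (foldr (@E_op n (SS_pow n m)) x s) = 0.
  by case: (rank_two (i := a) (j := b) _ epsa) => //; rewrite aj bj.
by rewrite /= in sN; apply: (IH s _ j.+2); rewrite ?Es ?subSS //; lia.
Qed.

Lemma E_block_highest n m (x : SS_pow n m) (k : 'I_n.-1) :
    (forall i : 'I_n.-1, i < k -> eps i x = 0) ->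
  forall i : 'I_n.-1, i <= k -> eps i (E_block k x) = 0.
Proof.
move=> hx i ik; rewrite /E_block.
apply: (E_chain_highest hx (j := 0)) => //.
(* With j = 0 no index is excluded. It remains to see that the filtered enumeration is 0, ..., k, by
   splitting the range at k + 1. *)
rewrite -(filter_map val (fun i => i <= k)) val_enum_ord subn0.
rewrite -[X in iota 0 X](subnKC (ltn_ord k)) iotaD filter_cat add0n.
rewrite (eq_in_filter (a2 := predT)) ?filter_predT; last first.
  by move=> l; rewrite mem_iota /=; lia.
rewrite (eq_in_filter (a2 := pred0)) ?filter_pred0 ?cats0 // => l.
by rewrite mem_iota /=; lia.
Qed.

Lemma rect_SS_pow n m (x : SS_pow n m) : highest_weight (rect x).
Proof.
move=> i; apply: (eps_eq0 (seminormal_SS_pow n m)).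
rewrite /rect.
(* Generalized to the blocks from k on, starting from a word with eps_i = 0 for all i < k. *)
suff H (s : seq 'I_n.-1) k y : map val s = iota k (size s) ->
    (forall i : 'I_n.-1, i < k -> eps i y = 0) ->
  forall i : 'I_n.-1, i < k + size s ->
    eps i (foldl (fun x k => E_block k x) y s : SS_pow n m) = 0.
  by apply: (H _ 0) => //; rewrite ?val_enum_ord size_enum_ord ?add0n.
elim: s k y => [|a s IHs] k y /=; first by rewrite addn0.
move=> -[/= ak Es] hy l; rewrite addnS -addSn; apply: IHs => // {}l lk.
by apply: E_block_highest; rewrite ak.
Qed.

(** * Transport along maps commuting with the raising operators *)

Section Transport.
Variables (n : nat) (B C : precrystal n) (X : set B) (g : B -> C).
Hypothesis Xe : forall i b c, X b -> e_op i b = Some c -> X c.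
Hypothesis ge : forall i b, X b -> e_op i (g b) = omap g (e_op i b).

(** Since g commutes with e_i only on X, membership in X must be carried along the string. *)
Lemma opow_transport i k b : X b ->
  opow (e_op i) k (g b) = omap g (opow (e_op i) k b) /\
  (forall c, opow (e_op i) k b = Some c -> X c).
Proof.
elim: k b => [|k IHk] b Xb; first by split=> // c [<-].
rewrite !opowS ge //; case eb: (e_op i b) => [c|] //=.
by apply: IHk; apply: Xe eb.
Qed.

Lemma E_op_transport i b : X b -> E_op i (g b) = g (E_op i b) /\ X (E_op i b).
Proof.
move=> Xb.
have epsE : eps i (g b) = eps i b.
  congr (supremum 0 _); apply/seteqP; rewrite /string_set.
  by split=> k /=; have [-> _] := opow_transport i k Xb; case: (opow _ _ b).
rewrite /E_op epsE; have [-> XX] := opow_transport i (eps i b) Xb.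
by case: (opow _ _ b) XX => //= c; split=> //; apply: XX.
Qed.

Lemma E_block_transport k b : X b ->
  E_block k (g b) = g (E_block k b) /\ X (E_block k b).
Proof.
rewrite /E_block => Xb; elim: [seq _ <- _ | _] => //= i s [-> Xs].
exact: E_op_transport.
Qed.

Lemma rect_transport b : X b -> rect (g b) = g (rect b) /\ X (rect b).
Proof.
rewrite /rect; elim: (enum _) b => //= k s IHs b Xb.
by have [-> /IHs] := E_block_transport k Xb.
Qed.

End Transport.

Theorem theorem2p21 (n : nat) (B : precrystal n) (hB : is_crystal B)
  (hnormal : normal B) (b : B) : highest_weight (rect b).
Proof.
have [|m [Y [_ [g [_ gP]]]]] := hnormal [set c | weakly_connected b c]%classic.
  by exists b.
(* An e_i-step is a reversed f_i-edge, so it stays in the component of b. *)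
have Xe i c d :
    weakly_connected b c -> e_op i c = Some d -> weakly_connected b d.
  move=> bc /(e_op_f_op hB) fd; apply: Relation_Operators.rst_trans bc _.
  by apply/Relation_Operators.rst_sym/Relation_Operators.rst_step; exists i.
have ge i c : weakly_connected b c -> e_op i (g c) = omap g (e_op i c).
  by move=> /gP[_ /(_ i)[]].
have [E Xb] := rect_transport Xe ge (Relation_Operators.rst_refl _ _ b).
(* As [omap g] reflects [None], vanishing of e_i at the image of [rect b] gives vanishing at
   [rect b]. *)
move=> i; have := rect_SS_pow (g b) i; rewrite E ge //.
by case: (e_op i (rect b)).
Qed.
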